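(* Let $X^*$ be the dual of a separable Banach space $X$ with $S_Z(X)>\omega$, and assume that $X^*$ has a weak$^*$ unconditional asymptotic structure. Then $\ell_\infty^n$ is in the $n$-th weak$^*$ asymptotic structure of $X^*$ for every $n\ge1$.
   Context: Szlenk index. For a weak$^*$-compact $K\subset X^*$ and $\varepsilon>0$, let $s_\varepsilon(K)$ be $K$ minus the union of all (relatively) weak$^*$-open subsets $V$ of $K$ with $\operatorname{diam}V\le\varepsilon$. Put $s^1_\varepsilon(K)=s_\varepsilon(K)$, $s^{\alpha+1}_\varepsilon(K)=s_\varepsilon(s^\alpha_\varepsilon(K))$, and $s^\alpha_\varepsilon(K)=\bigcap_{\beta<\alpha}s^\beta_\varepsilon(K)$ for limit $\alpha$. Let $S_Z(K,\varepsilon)$ be the least $\alpha$ with $s^\alpha_\varepsilon(K)=\emptyset$ if it exists and $\infty$ otherwise ($\infty$ is larger than every ordinal), and $S_Z(X)=\sup_{\varepsilon>0}S_Z(B_{X^*},\varepsilon)$, $B_{X^*}$ being the closed unit ball of $X^*$. $\omega$ is the first infinite ordinal. Let $\mathrm{cof}_{w^*}(X^* )$ be the set of weak$^*$-closed subspaces of $X^*$ of finite codimension; $S_Y$ denotes the unit sphere of $Y$. Weak$^*$ unconditional asymptotic structure: there is $C\ge1$ such that for every $n\ge1$: $\exists X_1\in\mathrm{cof}_{w^*}(X^* )\ \forall x_1^*\in S_{X_1}\ \cdots\ \exists X_n\in\mathrm{cof}_{w^*}(X^* )\ \forall x_n^*\in S_{X_n}$: $(x_i^* )_{i=1}^n$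 is $C$-unconditional, i.e. $\|\sum\epsilon_ia_ix_i^*\|\le C\|\sum a_ix_i^*\|$ for all scalars $a_i$ and signs $\epsilon_i$. An $n$-dimensional space $E$ with normalized basis $(e_i)_{i=1}^n$ is in the $n$-th weak$^*$ asymptotic structure of $X^*$ if for all $\varepsilon>0$: $\forall X_1\in\mathrm{cof}_{w^*}(X^* )\ \exists x_1^*\in S_{X_1}\ \cdots\ \forall X_n\in\mathrm{cof}_{w^*}(X^* )\ \exists x_n^*\in S_{X_n}$: $(x_i^* )_{i=1}^n$ is $(1+\varepsilon)$-equivalent to $(e_i)_{i=1}^n$. Here $(x_i)$ is $C$-equivalent to $(e_i)$ if there are $A,B>0$ with $AB\le C$ and $\frac1A\|\sum a_ie_i\|\le\|\sum a_ix_i\|\le B\|\sum a_ie_i\|$ for all scalars $a_i$. $\ell_\infty^n$ is taken with its unit vector basis. *)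

(* Defs.v *)
From HB Require Import structures.
From mathcomp Require Import all_boot all_order all_algebra.
From mathcomp Require Import all_classical all_reals all_analysis.
From mathcomp Require Import complex.

Set Implicit Arguments.
Unset Strict Implicit.
Unset Printing Implicit Defensive.

Import Order.TTheory GRing.Theory Num.Theory.
Import numFieldNormedType.Exports.

Local Open Scope classical_set_scope.
Local Open Scope ring_scope.

(* Banach spaces are real or complex. *)
Definition scalars (R : realType) (cplx : bool) : numFieldType :=
  if cplx then (R[i]%C : numFieldType) else (R : numFieldType).

(* Ordinals are represented by trees; several trees may represent the same
   ordinal, and "a is less than or equal to b" is [ord_le a b], so equality of
   ordinals is [ord_le] both ways and not equality of trees.
   [Osup f] is the least upper bound of the family f, attained or not. *)
Inductive ord : Type :=
| Ozero : ord
| Osucc : ord -> ord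
| Osup : forall T : Type, (T -> ord) -> ord.

(* a + 1 <= 0 never holds, a + 1 <= b + 1 iff a <= b, and
   a + 1 <= sup g iff a + 1 <= g j for some j. *)
Fixpoint ord_le (a : ord) : ord -> Prop :=
  match a with
  | Ozero => fun=> True
  | Osucc a' =>
      fix lt_a' (b : ord) : Prop :=
        match b with
        | Ozero => False
        | Osucc b' => ord_le a' b'
        | Osup T g => exists j : T, lt_a' (g j)
        end
  | Osup T f => fun b => forall i : T, ord_le (f i) b
  end.

Definition ord_lt (a b : ord) : Prop := ord_le (Osucc a) b.

Lemma ord_le_sup (T : Type) (f : T -> ord) (i : T) (a : ord) :
  ord_le a (f i) -> ord_le a (Osup f).
Proof. by elim: a => //= [a _ h|U g IH h j]; [exists i|apply: IH]. Qed.

Lemma ord_le_refl (a : ord) : ord_le a a.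
Proof. by elim: a => //= T f IH i; exact: (ord_le_sup (IH i)). Qed.

Lemma ord_le_trans (b a c : ord) : ord_le a b -> ord_le b c -> ord_le a c.
Proof.
elim: a b c => //= [a IHa b c|T f IH b c h bc i]; last exact: IH (h i) bc.
elim: b c => //= [b _ c ab|T g IH c [j gj] h]; last exact: IH gj (h j).
by elim: c => //= [c _ bc|T g IH [j h]]; [exact: IHa ab bc|exists j; exact: IH].
Qed.

Lemma ord_lt_le (a b : ord) : ord_lt a b -> ord_le a b.
Proof.
apply: ord_le_trans; elim: a => //= T f IH i.
apply: (ord_le_trans (IH i)); exact/(@ord_le_sup _ _ i)/ord_le_refl.
Qed.

Lemma ord_le_total (a b : ord) : ord_le a b \/ ord_lt b a.
Proof.
elim: a b => [b|a IHa b|T f IH b]; first by left.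
- elim: b => [|b _|T g IH]; [by right|exact: IHa|].
  have [|/forallNP h] := pselect (exists j, ord_le (Osucc a) (g j)).
    by left.
  by right => j; case: (IH j) => [/h|].
- have [|/forallNP h] := pselect (exists i, ord_lt b (f i)); first by right.
  by left => i; case: (IH i b) => // /h.
Qed.

Definition omega : ord := Osup (fun n : nat => iter n Osucc Ozero).

(* Ordinals extended by oo, which is [None]. *)
Definition ordoo_lt (a b : option ord) : Prop :=
  match a, b with
  | Some a, Some b => ord_lt a b
  | Some _, None => True
  | None, _ => False
  end.

Definition ordoo_sup (I : Type) (f : I -> option ord) : option ord :=
  if `[< exists i, f i = None >] then None
  else Some (Osup (fun i => odflt Ozero (f i))).

Section Dual.
Context {K : numFieldType} (X : normedModType K).

Definition dual_pred : {pred X -> K^o} :=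
  [pred f : X -> K^o | `[< linear f /\ continuous f >]].

Lemma dual_submod_closed : submod_closed dual_pred.
Proof.
split.
  apply/asboolP; split; last exact: cst_continuous.
  by move=> a x y; rewrite /= scaler0 addr0.
move=> a f g /asboolP[lf cf] /asboolP[lg cg]; apply/asboolP; split.
  move=> b x y; rewrite /= !fctE lf lg !scalerDr !scalerA (mulrC a b).
  by rewrite !addrA; congr (_ + _); rewrite -!addrA; congr (_ + _); rewrite addrC.
move=> x; apply: continuousD; last exact: cg.
by apply: continuousZr; exact: cf.
Qed.

HB.instance Definition _ := GRing.isSubmodClosed.Build K (X -> K^o) dual_pred
  dual_submod_closed.

Record dual : Type :=
  Dual { dual_fun :> X -> K^o ; dual_funP : dual_fun \in dual_pred }.

HB.instance Definition _ := [isSub for dual_fun].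
HB.instance Definition _ := [Choice of dual by <:].
HB.instance Definition _ := [SubChoice_isSubLmodule of dual by <:].

Definition weakstar : topologicalType :=
  initial_topology (fun f : dual => (f : {ptws X -> K^o})).

(* The moduli are in K; for K = R[i] the order is partial, but every upper bound
   of a set of moduli is a nonnegative real, so this is the usual supremum. *)
Definition dual_norm (f : dual) : K :=
  supremum 0 [set `|f x| | x in [set x : X | `|x| <= 1]].

Definition dual_ball : set dual := [set f | dual_norm f <= 1].

Definition separable : Prop := exists2 A : set X, countable A & dense A.

Definition diam_le (V : set dual) (eps : K) : Prop :=
  forall f g, V f -> V g -> dual_norm (f - g) <= eps.

Definition szlenk_derivation (eps : K) (A : set dual) : set dual :=
  A `\` \bigcup_(V in [set V | (exists2 U : set weakstar, open U & V = A `&` U)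
                               /\ diam_le V eps]) V.

(* The intersection with A only matters for an empty family f. *)
Fixpoint szlenk_derived (eps : K) (A : set dual) (a : ord) : set dual :=
  match a with
  | Ozero => A
  | Osucc b => szlenk_derivation eps (szlenk_derived eps A b)
  | Osup T f => A `&` \bigcap_(i in [set: T]) szlenk_derived eps A (f i)
  end.

Lemma szlenk_derivation_sub (eps : K) (A : set dual) :
  szlenk_derivation eps A `<=` A.
Proof. by move=> f []. Qed.

Lemma szlenk_derivation_mono (eps : K) (A B : set dual) :
  A `<=` B -> szlenk_derivation eps A `<=` szlenk_derivation eps B.
Proof.
move=> AB f [Af nf]; split; first exact: AB.
move=> [V [[U oU ->] dV] [_ Uf]]; apply: nf.
exists (A `&` U) => //; split; first by exists U.
by move=> g h [/AB Bg Ug] [/AB Bh Uh]; apply: dV.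
Qed.

Lemma szlenk_derived_anti (eps : K) (A : set dual) (a b : ord) :
  ord_le a b -> szlenk_derived eps A b `<=` szlenk_derived eps A a.
Proof.
have sub c : szlenk_derived eps A c `<=` A.
  elim: c => [|c IH|T f _] x //= => [/szlenk_derivation_sub/IH|[]] //.
elim: a b => [b _|a IHa|T f IH b h x bx]; first exact: sub.
- elim=> [//|b _ /IHa ab|T f IH [i /IH h] x [_ fx]].
    exact: szlenk_derivation_mono ab.
  exact: h (fx i Logic.I).
- by split=> [|i _]; [exact: sub bx|exact: IH (h i) _ bx].
Qed.

(* At a limit ordinal a, the derived set is the intersection of the derived sets
   at all b < a. *)
Lemma szlenk_derived_limit (eps : K) (A : set dual) (a : ord) :
  ord_lt Ozero a -> (forall b, ord_lt b a -> ord_lt (Osucc b) a) ->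
  forall x, szlenk_derived eps A a x <->
    (forall b, ord_lt b a -> szlenk_derived eps A b x).
Proof.
move=> a_gt0 a_lim x; split=> [ax b /ord_lt_le ba|xa].
  exact: szlenk_derived_anti ba _ ax.
suff: forall c, ord_le c a -> szlenk_derived eps A c x.
  by apply; exact: ord_le_refl.
elim=> [_|c _ /a_lim|T f IH h]; [exact: (xa Ozero)|exact: (xa (Osucc c))|].
by split=> [|i _]; [exact: (xa Ozero)|exact: IH (h i)].
Qed.

Definition szlenk_vanishes_first (eps : K) (A : set dual) (a : ord) : Prop :=
  szlenk_derived eps A a = set0 /\
  forall b, szlenk_derived eps A b = set0 -> ord_le a b.

(* The least ordinal at which the derived set of A is empty, or oo. *)
Definition szlenk_at (A : set dual) (eps : K) : option ord :=
  if pselect (exists a, szlenk_vanishes_first eps A a) is left h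
  then Some (projT1 (cid h)) else None.

Definition szlenk_index : option ord :=
  ordoo_sup (fun eps : {eps : K | 0 < eps} => szlenk_at dual_ball (val eps)).

(* The classes of the v j span the quotient by Y. *)
Definition finite_codim (Y : set dual) : Prop :=
  exists (m : nat) (v : 'I_m -> dual),
    forall f, exists c : 'I_m -> K, Y (f - \sum_(j < m) c j *: v j).

Definition cof_weakstar : set (set dual) :=
  [set Y : set dual | [/\ submod_closed [pred f : dual | f \in Y],
               closed (Y : set weakstar) & finite_codim Y]].

Definition sphere_of (Y : set dual) : set dual :=
  Y `&` [set f | dual_norm f = 1].

(* exists Y_1, forall x_1 in S_{Y_1}, ..., exists Y_n, forall x_n in S_{Y_n},
   P (x_1, ..., x_n) *)
Fixpoint exists_forall_game (n : nat) : (n.-tuple dual -> Prop) -> Prop :=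
  match n with
  | 0 => fun P => P [tuple]
  | m.+1 => fun P => exists2 Y, cof_weakstar Y &
      forall x, sphere_of Y x ->
        exists_forall_game (fun t : m.-tuple dual => P [tuple of x :: t])
  end.

(* forall Y_1, exists x_1 in S_{Y_1}, ..., forall Y_n, exists x_n in S_{Y_n},
   P (x_1, ..., x_n) *)
Fixpoint forall_exists_game (n : nat) : (n.-tuple dual -> Prop) -> Prop :=
  match n with
  | 0 => fun P => P [tuple]
  | m.+1 => fun P => forall Y, cof_weakstar Y ->
      exists2 x, sphere_of Y x &
        forall_exists_game (fun t : m.-tuple dual => P [tuple of x :: t])
  end.

Definition unconditional (C : K) (n : nat) (x : n.-tuple dual) : Prop :=
  forall (a : 'I_n -> K) (e : 'I_n -> bool),
    dual_norm (\sum_(i < n) ((-1) ^+ e i * a i) *: tnth x i)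
      <= C * dual_norm (\sum_(i < n) a i *: tnth x i).

Definition weakstar_unconditional_asymptotic_structure : Prop :=
  exists2 C : K, 1 <= C &
    forall n, (1 <= n)%N -> exists_forall_game (@unconditional C n).

Definition equivalent_to (E : normedModType K) (n : nat) (C : K)
    (e : n.-tuple E) (x : n.-tuple dual) : Prop :=
  exists A B : K, [/\ 0 < A, 0 < B, A * B <= C &
    forall a : 'I_n -> K,
      A^-1 * `|\sum_(i < n) a i *: tnth e i|
        <= dual_norm (\sum_(i < n) a i *: tnth x i)
        <= B * `|\sum_(i < n) a i *: tnth e i|].

Definition normalized_basis (E : normedModType K) (n : nat)
    (e : n.-tuple E) : Prop :=
  (forall i, `|tnth e i| = 1) /\
  (forall v : E, exists! a : {ffun 'I_n -> K},
    v = \sum_(i < n) a i *: tnth e i).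

Definition in_weakstar_asymptotic_structure (E : normedModType K) (n : nat)
    (e : n.-tuple E) : Prop :=
  normalized_basis e /\
  forall eps : K, 0 < eps ->
    forall_exists_game (equivalent_to (1 + eps) e).

End Dual.

(* The norm of ['rV[K]_n] is the maximum of the moduli of the entries. *)
Definition linfty_basis (K : numFieldType) (n : nat) : n.-tuple 'rV[K]_n :=
  [tuple (delta_mx 0 i : 'rV[K]_n) | i < n].

(* Main.v *)
Require Import Defs.
From HB Require Import structures.
From mathcomp Require Import all_boot all_order all_algebra.
From mathcomp Require Import all_classical all_reals all_analysis.
From mathcomp Require Import complex ring.

Set Implicit Arguments.
Unset Strict Implicit.
Unset Printing Implicit Defensive.

Import Order.TTheory GRing.Theory Num.Theory.
Import numFieldNormedType.Exports.

Local Open Scope classical_set_scope.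
Local Open Scope ring_scope.

(** The proof joins long Szlenk branches to James's argument that c_0 is not
    distortable, carried out inside the asymptotic game.

    Since the Szlenk index exceeds omega, some eps > 0 leaves every finite
    derived set of the dual ball nonempty.  Starting from a functional in the
    N-th derived set and moving down one derivation at a time, each time by
    more than eps/2 inside a prescribed weak* neighbourhood, one plays against
    any strategy of the subspace player: the increments are nearly in the
    prescribed subspaces, have norm at least eps/4 after correction, and sum to
    a functional of norm at most 3 ([szlenk_branch]).  If the subspace player
    also forces C-unconditionality, boundedness of this one sum bounds
    [sum a_i x_i] by a constant M times [max |a_i|], with M independent of N
    ([forces_bounded]).

    Suppose now that the subspace player could force, in n moves, unit vectors
    u_i having a combination with coefficients of modulus at most 1 and norm
    larger than 1 + d.  Normalizing that combination gives a unit vector whose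
    coefficients are smaller than 1/(1 + d), and by playing the n-move game on
    such blocks, then on blocks of blocks, the subspace player forces in n^k
    moves a unit combination with coefficients at most (1 + d)^(-k)
    ([forces_small_coefficients]).  For large k this contradicts the bound M
    ([james_game]).  Games with finitely many moves are determined, so the
    vector player can secure unit vectors with
    [|sum a_i u_i| <= (1 + d) max |a_i|].  For unit vectors the triangle
    inequality turns this into the lower bound (1 - d) max |a_i|
    ([equivalent_linfty]); the value d = eps/(2 + eps) gives the constant
    1 + eps. *)

(** * The real and the complex scalars *)

(** The part of completeness shared by the reals and the complex numbers,
    where only moduli are compared. *)
Definition sup_complete (K : numFieldType) : Prop :=
  forall A : set K, A !=set0 -> (forall a, A a -> 0 <= a) ->
    (exists b, ubound A b) -> supremums A !=set0.

(** Over the reals j can be 0, over the complex numbers it is the imaginary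
    unit. *)
Definition splits_real_imaginary (K : numFieldType) : Prop :=
  exists2 j : K, `|j| <= 1 & forall a : K, `|a| <= 1 ->
    exists b c : K, [/\ b \is Num.real, c \is Num.real, `|b| <= 1, `|c| <= 1
                      & a = b + j * c].

Lemma scalars_sup_complete (R : realType) (cplx : bool) :
  sup_complete (scalars R cplx).
Proof.
case: cplx => /= A [a Aa] A_ge0 [b Ab]; last first.
  have hA : has_ubound A by exists b.
  exists (sup A); split; first exact: ub_le_sup.
  by move=> c Ac; apply: ge_sup => //; exists a.
have toR (z : R[i]) : 0 <= z -> z = ((complex.Re z)%:C)%C.
  by case: z => x y; rewrite lecE /= => /andP[/eqP-> _].
have RA_ub (c : R[i]) :
    ubound A c -> ubound [set complex.Re z | z in A] (complex.Re c).
  by move=> Ac _ [z Az <-]; move: (Ac z Az); rewrite lecE => /andP[].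
exists ((sup [set complex.Re z | z in A])%:C)%C; split=> [z Az|c Ac].
  rewrite (toR z (A_ge0 z Az)) lecR; apply: ub_le_sup; last by exists z.
  by exists (complex.Re b); exact: RA_ub.
have c_ge0 : 0 <= c by exact: le_trans (A_ge0 a Aa) (Ac a Aa).
rewrite (toR c c_ge0) lecR; apply: ge_sup; last exact: RA_ub.
by exists (complex.Re a); exists a.
Qed.

Lemma scalars_split (R : realType) (cplx : bool) :
  splits_real_imaginary (scalars R cplx).
Proof.
case: cplx => /=; last first.
  exists 0 => [|a a1]; first by rewrite normr0 ler01.
  by exists a, 0; rewrite normr0 mul0r addr0 ler01 a1 !num_real.
exists ('i%C : R[i]) => [|a a1].
  by rewrite normc_def /= expr0n expr1n add0r sqrtr1 lexx.
exists ((complex.Re a)%:C)%C, ((complex.Im a)%:C)%C; split.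
- by rewrite complex_real.
- by rewrite complex_real.
- apply: le_trans a1; rewrite !normc_def lecR ler_wsqrtr //= expr0n addr0.
  by rewrite lerDl sqr_ge0.
- apply: le_trans a1; rewrite !normc_def lecR ler_wsqrtr //= expr0n addr0.
  by rewrite lerDr sqr_ge0.
- by rewrite {1}[a]complexE.
Qed.

Section Scalars.
Variables (K : numFieldType) (Ksup : sup_complete K).

Lemma supremumP (A : set K) : A !=set0 -> (forall a, A a -> 0 <= a) ->
  (exists b, ubound A b) -> supremums A (supremum 0 A).
Proof.
move=> A0 A_ge0 Ab; rewrite /supremum; case: eqP => [A_eq0|_].
  by move: A0; rewrite A_eq0 => -[].
by case: (Ksup A0 A_ge0 Ab) => s As; exact: xgetPex (ex_intro _ s As).
Qed.

(** If all multiples of d were below M, their supremum could be lowered by d. *)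
Lemma sup_archimedean (d M : K) : 0 < d -> exists k : nat, ~ (d *+ k <= M).
Proof.
move=> d0; apply/not_existsP => /= dM.
have {}dM k : d *+ k <= M by exact: contrapT (dM k).
pose A := [set d *+ k | k in [set: nat]].
have [s [As sA]] : supremums A !=set0.
  apply: Ksup; first by exists (d *+ 0); exists 0%N.
    by move=> _ [k _ <-]; rewrite mulrn_wge0 // ltW.
  by exists M => _ [k _ <-].
have /sA : ubound A (s - d).
  by move=> _ [k _ <-]; rewrite lerBrDr -mulrSr; apply: As; exists k.+1.
by rewrite lerBrDr gerDl => /(lt_le_trans d0); rewrite ltxx.
Qed.

(** Bernoulli's inequality. *)
Lemma sup_pow_unbounded (d M : K) : 0 < d -> exists k : nat, ~ ((1 + d) ^+ k <= M).
Proof.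
move=> d0; have [k kM] := @sup_archimedean d M d0; exists k => h; apply: kM.
apply: le_trans h; elim: k => [|k IH]; first by rewrite expr0 ler01.
have d1 : 1 <= (1 + d) ^+ k by rewrite exprn_ege1 // lerDl ltW.
rewrite exprS mulrDl mul1r mulrSr lerD // ler_peMr // ltW //.
Qed.

End Scalars.

(** * The dual norm *)

Section DualNorm.
Context {K : numFieldType} (X : normedModType K).
Hypothesis Ksup : sup_complete K.
Implicit Types f g : dual X.

Lemma dual_linear f (a : K) (x y : X) : f (a *: x + y) = a * f x + f y.
Proof. by case: f => f /= /asboolP[+ _] => ->. Qed.

Lemma dualZv f (a : K) (x : X) : f (a *: x) = a * f x.
Proof.
have f0 : f 0 = 0.
  have := dual_linear f 1 0 0; rewrite scaler0 addr0 mul1r => /eqP.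
  by rewrite addrC -subr_eq subrr eq_sym => /eqP.
by rewrite -[a *: x]addr0 dual_linear f0 addr0.
Qed.

Lemma dualD f g (x : X) : (f + g) x = f x + g x. Proof. by []. Qed.
Lemma dualB f g (x : X) : (f - g) x = f x - g x. Proof. by []. Qed.
Lemma dualZ (a : K) f (x : X) : (a *: f) x = a * f x. Proof. by []. Qed.
Lemma dual0 (x : X) : (0 : dual X) x = 0. Proof. by []. Qed.

Lemma dual_bounded f :
  exists b : K, ubound [set `|f x| | x in [set x : X | `|x| <= 1]] b.
Proof.
have : continuous (f : X -> K^o) by case: f => f /= /asboolP[].
move=> /(_ 0) /cvgr_dist_lt /(_ 1 ltr01).
rewrite nearE => /nbhs_ballP[r /= r0 rf].
have f0 : f 0 = 0 by rewrite -(scale0r 0) dualZv mul0r.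
exists (r / 2)^-1 => _ [x /= x1 <-].
have r2 : 0 < r / 2 by rewrite divr_gt0.
have /rf /= : ball (0 : X) r ((r / 2) *: x).
  rewrite -ball_normE /= sub0r normrN normrZ gtr0_norm //.
  apply: le_lt_trans (_ : r / 2 < r).
    by rewrite -[leRHS]mulr1 ler_pM2l.
  by rewrite ltr_pdivrMr // ltr_pMr // ltr1n.
  rewrite f0 sub0r normrN dualZv normrM gtr0_norm // => /ltW.
by rewrite -ler_pdivlMl // mulr1.
Qed.

Lemma dual_normP f :
  supremums [set `|f x| | x in [set x : X | `|x| <= 1]] (dual_norm f).
Proof.
apply: (supremumP Ksup); last exact: dual_bounded.
  by exists `|f 0|; exists 0 => //=; rewrite normr0 ler01.
by move=> _ [x _ <-].
Qed.

Lemma dual_norm_ge f (x : X) : `|x| <= 1 -> `|f x| <= dual_norm f.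
Proof. by move=> x1; apply: (dual_normP f).1; exists x. Qed.

Lemma dual_norm_le f (b : K) :
  (forall x, `|x| <= 1 -> `|f x| <= b) -> dual_norm f <= b.
Proof. by move=> h; apply: (dual_normP f).2 => _ [x x1 <-]; exact: h. Qed.

Lemma dual_norm_ge0 f : 0 <= dual_norm f.
Proof.
by apply: le_trans (normr_ge0 (f 0)) _; apply: dual_norm_ge; rewrite normr0 ler01.
Qed.

Lemma dual_norm_eval f (x : X) : `|f x| <= dual_norm f * `|x|.
Proof.
have [->|x0] := eqVneq x 0.
  by rewrite -(scale0r 0) dualZv mul0r !normr0 mulr_ge0 // dual_norm_ge0.
have nx : 0 < `|x| by rewrite normr_gt0.
have := @dual_norm_ge f (`|x|^-1 *: x).
rewrite normrZ normfV normr_id mulVf ?gt_eqF // => /(_ (lexx _)).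
by rewrite dualZv normrM normfV normr_id mulrC ler_pdivrMr.
Qed.

Lemma dual_normD f g : dual_norm (f + g) <= dual_norm f + dual_norm g.
Proof.
apply: dual_norm_le => x x1; rewrite dualD.
by apply: le_trans (ler_normD _ _) _; rewrite lerD // dual_norm_ge.
Qed.

Lemma dual_normZ (a : K) f : dual_norm (a *: f) = `|a| * dual_norm f.
Proof.
have le b g : dual_norm (b *: g) <= `|b| * dual_norm g.
  apply: dual_norm_le => x x1.
  by rewrite dualZ normrM ler_wpM2l // dual_norm_ge.
apply/eqP; rewrite eq_le le /=.
have [->|a0] := eqVneq a 0; first by rewrite normr0 mul0r dual_norm_ge0.
rewrite -ler_pdivlMl ?normr_gt0 // -normfV.
by apply: le_trans (le _ _); rewrite scalerA mulVf // scale1r.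
Qed.

Lemma dual_norm0 : dual_norm (0 : dual X) = 0.
Proof. by rewrite -(scale0r 0) dual_normZ normr0 mul0r. Qed.

Lemma dual_normN f : dual_norm (- f) = dual_norm f.
Proof. by rewrite -scaleN1r dual_normZ normrN1 mul1r. Qed.

Lemma dual_normB f g : dual_norm (f - g) <= dual_norm f + dual_norm g.
Proof. by rewrite -[in leRHS](dual_normN g) dual_normD. Qed.

End DualNorm.

(** * Weak*-closed subspaces of finite codimension *)

Section WeakStar.
Context {K : numFieldType} (X : normedModType K).
Hypothesis Ksup : sup_complete K.
Implicit Types (f g h v w : dual X) (Y : set (dual X)) (F G : seq X).

Definition annihilator F : set (dual X) := [set f | forall x, x \in F -> f x = 0].

Definition is_subspace Y : Prop :=
  Y 0 /\ forall (a : K) f g, Y f -> Y g -> Y (a *: f + g).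

Lemma subspaceZ Y (a : K) f : is_subspace Y -> Y f -> Y (a *: f).
Proof. by move=> [Y0 Ylin] Yf; rewrite -[a *: f]addr0; exact: Ylin. Qed.

Lemma subspaceD Y f g : is_subspace Y -> Y f -> Y g -> Y (f + g).
Proof. by move=> [Y0 Ylin] Yf Yg; rewrite -[f]scale1r; exact: Ylin. Qed.

Lemma subspaceB Y f g : is_subspace Y -> Y f -> Y g -> Y (f - g).
Proof.
by move=> sY Yf Yg; rewrite -scaleN1r; apply: subspaceD => //; exact: subspaceZ.
Qed.

Lemma annihilator_subspace F : is_subspace (annihilator F).
Proof.
split=> [x _|a f g fF gF x xF]; first exact: dual0.
by rewrite dualD dualZ fF // gF // mulr0 addr0.
Qed.

Lemma annihilatorZ F (a : K) f : annihilator F f -> annihilator F (a *: f).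
Proof. exact: (subspaceZ _ (annihilator_subspace F)). Qed.

Lemma annihilatorB F f g :
  annihilator F f -> annihilator F g -> annihilator F (f - g).
Proof. exact: (subspaceB (annihilator_subspace F)). Qed.

Lemma annihilator_cat F G f :
  annihilator (F ++ G) f <-> annihilator F f /\ annihilator G f.
Proof.
split=> [h|[fF fG] x]; last by rewrite mem_cat => /orP[/fF|/fG].
by split=> x xF; apply: h; rewrite mem_cat xF ?orbT.
Qed.

Lemma annihilator_cons x F f :
  annihilator (x :: F) f <-> f x = 0 /\ annihilator F f.
Proof.
split=> [h|[fx fF] y]; last by rewrite inE => /predU1P[->|/fF].
by split=> [|y yF]; apply: h; rewrite inE ?eqxx // yF orbT.
Qed.

Lemma weakstar_eval_continuous (x : X) :
  continuous ((fun f : weakstar X => (f : dual X) x) : weakstar X -> K^o).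
Proof.
move=> f.
have c1 := @initial_continuous _ _ (fun f : dual X => (f : {ptws X -> K^o})) f.
have c2 := @proj_continuous X (fun=> K^o) x (f : dual X).
exact: (continuous_comp c1 c2).
Qed.

Lemma weakstar_open_nbhs f F (r : K) :
  open ([set g | forall x, x \in F -> `|g x - f x| < r] : set (weakstar X)).
Proof.
elim: F => [|x F IH].
  rewrite (_ : [set g | _] = setT); first exact: openT.
  by apply/seteqP; split.
have oA : open ((fun g : weakstar X => (g : dual X) x : K^o) @^-1`
    ball (f x : K^o) r).
  apply: open_comp; last exact: ball_open.
  by move=> g _; exact: weakstar_eval_continuous.
have := openI oA IH; congr (open _); apply/seteqP; split=> g.
  case=> gx gF y; rewrite inE => /predU1P[->|/gF//].
  by move: gx; rewrite /= -ball_normE /= distrC.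
move=> h; split=> [|y yF]; last by apply: h; rewrite inE yF orbT.
by rewrite /= -ball_normE /= distrC; apply: h; rewrite inE eqxx.
Qed.

Lemma annihilator_closed F : closed (annihilator F : set (weakstar X)).
Proof.
rewrite (_ : annihilator F = \bigcap_(x in [set x | x \in F])
  ((fun f : weakstar X => (f : dual X) x : K^o) @^-1` [set 0])); last first.
  by apply/seteqP; split=> [f fF x xF|f fF x xF]; exact: fF.
apply: closed_bigI => x _; apply: preimage_closed.
  by move=> f _; exact: weakstar_eval_continuous.
exact: (accessible_closed_set1 (hausdorff_accessible (@norm_hausdorff K K^o))).
Qed.

(** An algebraic trace of weak* closedness: the point w can be separated from Y
    by w plus the annihilator of a finite set. Unlike closedness, it passes to
    Y plus a line by linear algebra alone. *)
Definition annihilator_separated Y : Prop :=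
  forall w, ~ Y w -> exists G, forall h, annihilator G h -> ~ Y (w + h).

(** The sets of functionals agreeing with w on a finite set form a filter base
    that converges to w pointwise, so every weak* neighbourhood of w contains
    one of them. *)
Lemma closed_annihilator_separated Y :
  closed (Y : set (weakstar X)) -> annihilator_separated Y.
Proof.
move=> cY w Yw.
have oYc : open (~` (Y : set (weakstar X))) by exact: closed_openC.
have [U oU UY] : exists2 U : set {ptws X -> K^o}, open U &
    (fun f : dual X => (f : {ptws X -> K^o})) @^-1` U = ~` Y.
  by case: oYc => U oU UY; exists U.
pose Fil := filter_from [set: seq X]
  (fun G => [set u : X -> K^o | forall x, x \in G -> u x = w x]).
have FF : Filter Fil.
  apply: filter_from_filter; first by exists [::].
  move=> G H _ _; exists (G ++ H) => // u uGH; split=> x xG; apply: uGH.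
    by rewrite mem_cat xG.
  by rewrite mem_cat xG orbT.
have Fw : Fil --> ((w : X -> K^o) : {ptws X -> K^o}).
  apply/pointwise_cvgP => x A /nbhs_singleton Aw; exists [:: x] => // u ux.
  by rewrite /= ux // inE.
have UYE u : U (dual_fun u) = (~ Y u) by exact: (congr1 (fun S => S u) UY).
have wU : U (dual_fun w) by rewrite UYE.
have [G _ GU] : Fil U by apply: Fw; exact: open_nbhs_nbhs.
exists G => h hG; rewrite -UYE; apply: GU => x xG.
by rewrite -[RHS]addr0 -(hG x xG).
Qed.

Definition add_line Y v : set (dual X) := [set f | exists c : K, Y (f - c *: v)].

Lemma add_line_subspace Y v : is_subspace Y -> is_subspace (add_line Y v).
Proof.
move=> sY; split=> [|a f g [c Yf] [d Yg]].
  by exists 0; rewrite scale0r subrr; case: sY.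
exists (a * c + d); rewrite (_ : _ - _ = a *: (f - c *: v) + (g - d *: v)).
  by case: sY => _; exact.
by rewrite scalerDl scalerBr scalerA opprD addrACA.
Qed.

(** If w plus the annihilator of G1 meets Y + Kv, where G1 separates v from Y,
    the v-coordinate of the meeting points is a constant c1; then any G2
    separating w - c1 v from Y can be adjoined to G1. *)
Lemma add_line_separated Y v : is_subspace Y ->
  annihilator_separated Y -> annihilator_separated (add_line Y v).
Proof.
move=> sY aY w nYw.
have Yw c : ~ Y (w - c *: v) by move=> Yc; apply: nYw; exists c.
have [Yv|/aY[G1 YG1]] := pselect (Y v).
  have /aY[G YG] : ~ Y w by have := Yw 0; rewrite scale0r subr0.
  exists G => h hG [c Ywh]; apply: (YG h hG).
  by rewrite -[w + h](subrK (c *: v)); apply: subspaceD => //; exact: subspaceZ.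
have [[h1 [h1G [c1 Y1]]]|nex] :=
    pselect (exists h1, annihilator G1 h1 /\ add_line Y v (w + h1)); last first.
  by exists G1 => h hG Yh; apply: nex; exists h.
have [G2 YG2] := aY _ (Yw c1).
exists (G1 ++ G2) => h /annihilator_cat[hG1 hG2] [c Yc].
have [cc|c_neq] := eqVneq c c1.
  by apply: (YG2 h hG2); rewrite -cc addrAC.
(* Otherwise a multiple of the difference of the two points puts v in Y up to
   the annihilator of G1. *)
have d0 : c - c1 != 0 by rewrite subr_eq0.
apply: (YG1 ((c - c1)^-1 *: (h1 - h))).
  by apply: annihilatorZ; exact: annihilatorB.
rewrite (_ : _ + _ = (c - c1)^-1 *: ((w + h1 - c1 *: v) - (w + h - c *: v))).
  by apply: subspaceZ => //; exact: subspaceB.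
rewrite -[X in X + _ = _](scale1r v) -(mulVf d0) -scalerA -scalerDr.
congr (_ *: _); rewrite opprD opprK opprD addrACA scalerBl.
by rewrite addrC (addrACA w) subrr add0r (addrC (- (c1 *: v))).
Qed.

(** Induction on the codimension: Y + K v_0 contains the annihilator of some F,
    and a G separating v_0 from Y removes the v_0-component. *)
Lemma separated_contains_annihilator m (v : 'I_m -> dual X) Y :
  is_subspace Y -> annihilator_separated Y ->
  (forall f, exists c : 'I_m -> K, Y (f - \sum_(j < m) c j *: v j)) ->
  exists F, annihilator F `<=` Y.
Proof.
elim: m v Y => [|m IH] v Y sY aY Yv.
  by exists [::] => f _; have [c] := Yv f; rewrite big_ord0 subr0.
have [||f|F FY] := IH (fun j => v (lift ord0 j)) (add_line Y (v ord0)).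
- exact: add_line_subspace.
- exact: add_line_separated.
- have [c Yc] := Yv f; exists (fun j => c (lift ord0 j)); exists (c ord0).
  by move: Yc; rewrite big_ord_recl opprD addrA addrAC.
have [Yv0|/aY[G YG]] := pselect (Y (v ord0)).
  exists F => f /FY[c Yf]; rewrite -[f](subrK (c *: v ord0)).
  by apply: subspaceD => //; exact: subspaceZ.
exists (F ++ G) => f /annihilator_cat[/FY[c Yf] fG].
have [c0|c0] := eqVneq c 0; first by move: Yf; rewrite c0 scale0r subr0.
exfalso; apply: (YG (- c^-1 *: f)).
  exact: annihilatorZ.
rewrite (_ : _ + _ = - c^-1 *: (f - c *: v ord0)); first exact: subspaceZ.
by rewrite scalerBr scalerA mulNr mulVf // scaleN1r opprK addrC.
Qed.

Lemma cof_subspace Y : cof_weakstar Y -> is_subspace Y.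
Proof.
move=> [[Y0 Yl] _ _]; split; first by move: Y0; rewrite !inE.
by move=> a f g Yf Yg; have := Yl a f g; rewrite !inE; exact.
Qed.

Lemma cof_contains_annihilator Y : cof_weakstar Y -> exists F, annihilator F `<=` Y.
Proof.
move=> cY; have sY := cof_subspace cY; case: cY => _ clY [m [v Yv]].
exact: separated_contains_annihilator (closed_annihilator_separated clY) Yv.
Qed.

(** Either evaluation at x depends on the evaluations at F, or some functional
    is dual to x relative to F. *)
Lemma annihilator_step x F :
  (forall f, annihilator F f -> annihilator (x :: F) f) \/
  (exists2 h, annihilator F h & h x = 1).
Proof.
have [|/existsNP[h /not_implyP[hF hx]]] :=
    pselect (forall f, annihilator F f -> f x = 0).
  by move=> fF; left=> f /[dup] /fF fx ff; apply/annihilator_cons.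
right; exists ((h x)^-1 *: h); last by rewrite dualZ mulVf //; exact/eqP.
exact: annihilatorZ.
Qed.

Lemma annihilator_cof F : cof_weakstar (annihilator F).
Proof.
have [F0 Fl] := annihilator_subspace F; split.
- by split=> [|a f g]; rewrite !inE //; exact: Fl.
- exact: annihilator_closed.
elim: F {F0 Fl} => [|x F [m [v vF]]].
  by exists 0%N, (fun=> 0) => f; exists (fun=> 0) => x.
have [FxF|[h hF hx]] := annihilator_step x F.
  by exists m, v => f; have [c /FxF fF] := vF f; exists c.
exists m.+1, (fun i => if unlift ord0 i is Some j then v j else h) => f.
have [c fF] := vF f; set g := f - _ in fF.
exists (fun i => if unlift ord0 i is Some j then c j else g x).
rewrite big_ord_recl unlift_none.
under eq_bigr => j _ do rewrite liftK.
rewrite opprD addrCA addrC -/g; apply/annihilator_cons; split.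
  by rewrite dualB dualZ hx mulr1 subrr.
apply: annihilatorB => //.
exact: annihilatorZ.
Qed.

Lemma cof_inter Y1 Y2 : cof_weakstar Y1 -> cof_weakstar Y2 ->
  exists2 Y, cof_weakstar Y & Y `<=` Y1 `&` Y2.
Proof.
move=> /cof_contains_annihilator[F1 FY1] /cof_contains_annihilator[F2 FY2].
exists (annihilator (F1 ++ F2)); first exact: annihilator_cof.
by move=> f /annihilator_cat[/FY1 ? /FY2 ?].
Qed.

(** Functionals that are uniformly small on F are close in norm to the
    annihilator of F. The correction e is a combination of functionals dual to
    a maximal independent part of F, built one point at a
    time. *)
Lemma annihilator_approx F : exists2 C : K, 0 < C &
  forall f (r : K), 0 <= r -> (forall x, x \in F -> `|f x| <= r) ->
    exists2 e, dual_norm e <= C * r & annihilator F (f - e).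
Proof.
elim: F => [|x F [C C0 IH]].
  exists 1 => // f r r0 _; exists 0 => //.
  by rewrite (dual_norm0 X Ksup) mul1r.
have [FxF|[h hF hx]] := annihilator_step x F.
  exists C => // f r r0 fr; have [|e eC /FxF] := IH f r r0; last by exists e.
  by move=> y yF; apply: fr; rewrite inE yF orbT.
have nh := dual_norm_ge0 Ksup h.
exists (C + (1 + C * `|x|) * dual_norm h) => [|f r r0 fr].
  by rewrite ltr_wpDr // mulr_ge0 // addr_ge0 // mulr_ge0 // ltW.
have [|e eC fe] := IH f r r0.
  by move=> y yF; apply: fr; rewrite inE yF orbT.
exists (e + (f - e) x *: h); last first.
  rewrite opprD addrA; apply/annihilator_cons; split.
    by rewrite [LHS]dualB dualZ hx mulr1 subrr.
  apply: annihilatorB => //.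
  exact: annihilatorZ.
apply: le_trans (dual_normD Ksup _ _) _; rewrite mulrDl lerD //.
rewrite (dual_normZ Ksup) mulrAC ler_wpM2r // dualB.
apply: le_trans (ler_normB _ _) _; rewrite mulrDl mul1r lerD //.
  by apply: fr; rewrite inE eqxx.
apply: le_trans (dual_norm_eval Ksup _ _) _.
by rewrite mulrAC ler_wpM2r.
Qed.

End WeakStar.

(** * The game against the subspace player *)

Section Game.
Context {K : numFieldType} (X : normedModType K).
Hypothesis Ksup : sup_complete K.
Implicit Types (P Q : seq (dual X) -> Prop) (s t u : seq (dual X)).

(** The subspace player has a strategy for P in n moves. Outcomes are lists, so
    that games of different lengths can be concatenated. *)
Fixpoint forces n P : Prop :=
  match n with
  | 0 => P [::]
  | m.+1 => exists2 Y, cof_weakstar Y &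
      forall x, sphere_of Y x -> forces m (fun s => P (x :: s))
  end.

Lemma forces_mono n P Q : (forall s, P s -> Q s) -> forces n P -> forces n Q.
Proof.
elim: n P Q => [|n IH] P Q PQ; first exact: PQ.
by case=> Y cY YP; exists Y => // x /YP; apply: IH => s; exact: PQ.
Qed.

Lemma sphere_of_sub (Y Z : set (dual X)) :
  Y `<=` Z -> sphere_of Y `<=` sphere_of Z.
Proof. by move=> YZ x [/YZ Zx x1]. Qed.

Lemma forces_and n P Q :
  forces n P -> forces n Q -> forces n (fun s => P s /\ Q s).
Proof.
elim: n P Q => [//|n IH] P Q [Y1 c1 h1] [Y2 c2 h2].
have [Y cY Y12] := cof_inter c1 c2; exists Y => // x Yx.
by apply: IH; [apply: h1|apply: h2]; apply: sphere_of_sub Yx => y /Y12[].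
Qed.

(** In each move the subspace player can play the intersection with Y. *)
Lemma forces_in n P (Y : set (dual X)) : cof_weakstar Y ->
  forces n P -> forces n (fun s => (forall x, x \in s -> Y x) /\ P s).
Proof.
move=> cY; apply: forces_and; elim: n => [//|n IH]; exists Y => // x [Yx _].
by apply: forces_mono IH => s Ys y; rewrite inE => /predU1P[->|/Ys].
Qed.

Lemma forces_cat m n P :
  forces m (fun s => forces n (fun t => P (s ++ t))) -> forces (m + n) P.
Proof.
elim: m P => [//|m IH] P [Y cY YP]; exists Y => // x /YP.
exact: (IH (fun s => P (x :: s))).
Qed.

Lemma forces_of_game n (P : n.-tuple (dual X) -> Prop) : exists_forall_game P ->
  forces n (fun s => exists2 t : n.-tuple (dual X), tval t = s & P t).
Proof.
elim: n P => [|n IH] P /=; first by exists [tuple].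
case=> Y cY YP; exists Y => // x /YP/IH; apply: forces_mono => s [t <- Pt].
by exists [tuple of x :: t].
Qed.

(** Determinacy of finite games. *)
Lemma game_of_not_forces n P (Q : n.-tuple (dual X) -> Prop) :
  ~ forces n (fun s => ~ P s) ->
  (forall t : n.-tuple (dual X), (forall i, dual_norm (tnth t i) = 1) ->
    P t -> Q t) ->
  forall_exists_game Q.
Proof.
elim: n P Q => [|n IH] P Q /= nP PQ.
  by apply: PQ; [case|exact: contrapT].
move=> Y cY; apply: contrapT => nQ; apply: nP; exists Y => // x Yx.
apply: contrapT => nP; apply: nQ; exists x => //; apply: IH nP _ => t t1 Pt.
apply: PQ => // i; have [j ->|->] := unliftP ord0 i; last by case: Yx.
by rewrite tnthS.
Qed.

(** Coefficients are indexed by all natural numbers, independently of the length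
    of the list; those beyond it are ignored. *)
Definition lin (c : nat -> K) s : dual X := \sum_(0 <= i < size s) c i *: s`_i.

Lemma lin_nil c : lin c [::] = 0.
Proof. by rewrite /lin big_nil. Qed.

Lemma lin_cons c x s : lin c (x :: s) = c 0%N *: x + lin (fun i => c i.+1) s.
Proof. by rewrite /lin big_nat_recl. Qed.

Lemma linZ a c s : lin (fun i => a * c i) s = a *: lin c s.
Proof.
by rewrite /lin scaler_sumr; apply: eq_bigr => i _; exact: esym (scalerA _ _ _).
Qed.

Lemma linD c d s : lin (fun i => c i + d i) s = lin c s + lin d s.
Proof. by rewrite /lin -big_split /=; apply: eq_bigr => i _; rewrite scalerDl. Qed.

Lemma eq_lin c d s : c =1 d -> lin c s = lin d s.
Proof. by move=> cd; apply: eq_bigr => i _; rewrite cd. Qed.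

Lemma lin_cat c d s t :
  lin (fun i => if (i < size s)%N then c i else d (i - size s)%N) (s ++ t)
  = lin c s + lin d t.
Proof.
elim: s c => [|x s IH] c /=.
  by rewrite lin_nil add0r; apply: eq_lin => i; rewrite subn0.
by rewrite !lin_cons -addrA -IH.
Qed.

Lemma lin_tuple n c (t : n.-tuple (dual X)) :
  lin c t = \sum_(i < n) c i *: tnth t i.
Proof.
by rewrite /lin size_tuple big_mkord; apply: eq_bigr => i _; rewrite (tnth_nth 0).
Qed.

Lemma lin_subspace (Y : set (dual X)) c s :
  is_subspace Y -> (forall x, x \in s -> Y x) -> Y (lin c s).
Proof.
move=> [Y0 Ylin]; elim: s c => [|x s IH] c Ys; first by rewrite lin_nil.
rewrite lin_cons; apply: Ylin; first exact: Ys (mem_head _ _).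
by apply: IH => y ys; apply: Ys; rewrite inE ys orbT.
Qed.

Definition bounded_comb (b : K) s : Prop :=
  forall c : nat -> K, (forall i, `|c i| <= 1) -> dual_norm (lin c s) <= b.

(** A combination of u with coefficients at most b is also a combination of s
    with coefficients at most b * r: the entries of u are blocks of s with
    coefficients at most r. *)
Definition blocks (r : K) s u : Prop :=
  forall (b : K) (a : nat -> K), (forall i, `|a i| <= b) ->
    exists2 c : nat -> K, (forall i, `|c i| <= b * r) & lin c s = lin a u.

Lemma blocks_cons (r : K) (c : nat -> K) s t u : (forall i, `|c i| <= r) ->
  blocks r t u -> blocks r (s ++ t) (lin c s :: u).
Proof.
move=> cr tu b a ab.
have [d db dt] := tu b (fun i => a i.+1) (fun i => ab i.+1).
exists (fun i => if (i < size s)%N then a 0%N * c i else d (i - size s)%N).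
  by move=> i; case: ifP => // _; rewrite normrM ler_pM.
by rewrite lin_cat lin_cons linZ dt.
Qed.

(** In order to obtain one vector of the j-move game inside its current subspace
    Y, the subspace player runs the m-move game within Y; the resulting block is
    a unit vector of Y, and counts as the answer of the vector player. *)
Lemma forces_blocks m (r : K) : 0 <= r ->
  forces m (fun s => exists2 c : nat -> K,
    (forall i, `|c i| <= r) & dual_norm (lin c s) = 1) ->
  forall j P, forces j P -> forces (j * m) (fun s => exists2 u, blocks r s u & P u).
Proof.
move=> r0 hm; elim=> [|j IH] P /=.
  exists [::] => // b a ab; exists (fun=> 0) => [i|]; last by rewrite !lin_nil.
  by rewrite normr0 mulr_ge0 // (le_trans _ (ab 0%N)).
case=> Y cY YP; apply: forces_cat; apply: forces_mono (forces_in cY hm).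
move=> s [Ys [c cr c1]].
have /YP/IH : sphere_of Y (lin c s).
  by split=> //; apply: lin_subspace => //; exact: cof_subspace.
apply: forces_mono => t [u tu Pu]; exists (lin c s :: u) => //.
exact: blocks_cons.
Qed.

(** James's iteration: among n unit blocks whose coefficients are at most
    (1 + d)^(-k), the assumed combination of norm above 1 + d normalizes to a
    unit block whose coefficients are at most (1 + d)^(-k-1). *)
Lemma forces_small_coefficients n (d : K) : 0 < d ->
  forces n (fun u => ~ bounded_comb (1 + d) u) ->
  forall k, forces (n ^ k) (fun s => exists2 c : nat -> K,
    (forall i, `|c i| <= (1 + d)^-1 ^+ k) & dual_norm (lin c s) = 1).
Proof.
move=> d0 hn; have d1 : 0 < 1 + d by rewrite addr_gt0.
elim=> [|k IH].
  exists (annihilator [::]); first exact: annihilator_cof.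
  move=> x [_ x1]; exists (fun=> 1) => [i|]; first by rewrite normr1 expr0.
  by rewrite lin_cons lin_nil scale1r addr0.
have r0 : 0 <= (1 + d)^-1 ^+ k by rewrite exprn_ge0 // invr_ge0 ltW.
rewrite expnS; apply: forces_mono (forces_blocks r0 IH hn) => s [u su].
move=> /existsNP[a /not_implyP[a1 /negP]].
have := dual_norm_ge0 Ksup (lin a u); set v := dual_norm _ => v0.
rewrite -real_ltNge ?ger0_real // ?ltW // => v1.
have [c cr cs] := su 1 a a1; exists (fun i => v^-1 * c i) => [i|]; last first.
  rewrite linZ (dual_normZ Ksup) cs -/v normfV ger0_norm // mulVf //.
  by rewrite gt_eqF // (lt_trans d1).
have v_gt0 := lt_trans d1 v1.
rewrite normrM normfV (ger0_norm v0) exprS ler_pM ?invr_ge0 //.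
  by rewrite lef_pV2 ?posrE // ltW.
by have := cr i; rewrite mul1r.
Qed.

(** A unit vector with coefficients at most (1 + d)^(-k) and the bound M
    give (1 + d)^k <= M. *)
Lemma james_game n (d M : K) : 0 < d ->
  (forall N P, forces N P -> exists2 s, P s & bounded_comb M s) ->
  ~ forces n (fun u => ~ bounded_comb (1 + d) u).
Proof.
move=> d0 hM hn; have d1 : 0 < 1 + d by rewrite addr_gt0.
have [k] := @sup_pow_unbounded K Ksup d M d0; apply.
have [s [c cd c1] sM] := hM _ _ (forces_small_coefficients d0 hn k).
have dk : 0 < (1 + d) ^+ k by rewrite exprn_gt0.
have := sM (fun i => (1 + d) ^+ k * c i).
rewrite linZ (dual_normZ Ksup) c1 mulr1 gtr0_norm //; apply=> i.
by rewrite normrM gtr0_norm // mulrC -ler_pdivlMr // mul1r -exprVn.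
Qed.

Definition unconditional_seq (C : K) s : Prop :=
  forall (a : nat -> K) (e : nat -> bool),
    dual_norm (lin (fun i => (-1) ^+ e i * a i) s) <= C * dual_norm (lin a s).

Lemma unconditional_tuple (C : K) n (t : n.-tuple (dual X)) :
  unconditional C t -> unconditional_seq C t.
Proof.
by move=> tC a e; rewrite !lin_tuple; exact: (tC (fun i => a i) (fun i => e i)).
Qed.

Lemma convex_split (p q a b : K) (v x w : dual X) : p + q = 1 ->
  v + (p * a + q * b) *: x + w = p *: (v + a *: x + w) + q *: (v + b *: x + w).
Proof.
move=> pq; rewrite -[v in LHS]scale1r -[w in LHS]scale1r -pq.
rewrite !scalerDl !scalerDr !scalerA (addrACA (p *: v)).
exact: addrACA.
Qed.

(** A convex function on the cube is bounded by its values at the vertices. The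
    vector v collects the terms that are already treated. *)
Lemma sign_convexity (D : K) (t : nat -> K) s (v : dual X) (b : nat -> K) :
  (forall e : nat -> bool,
    dual_norm (v + lin (fun i => (-1) ^+ e i * t i) s) <= D) ->
  (forall i, b i \is Num.real) -> (forall i, `|b i| <= 1) ->
  dual_norm (v + lin (fun i => b i * t i) s) <= D.
Proof.
elim: s v t b => [|x s IH] v t b hD br b1.
  by have := hD (fun=> false); rewrite !lin_nil.
set w := lin (fun i => b i.+1 * t i.+1) s.
have hs (e : bool) : dual_norm (v + ((-1) ^+ e * t 0%N) *: x + w) <= D.
  apply: IH => // e'; have := hD (fun i => if i is j.+1 then e' j else e).
  by rewrite lin_cons addrA.
have := b1 0%N; rewrite real_ler_norml // => /andP[bm bp].
have p0 : 0 <= (1 + b 0%N) / 2 by rewrite divr_ge0 // -lerBlDl sub0r.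
have m0 : 0 <= (1 - b 0%N) / 2 by rewrite divr_ge0 // subr_ge0.
rewrite lin_cons -/w addrA.
have pm : (1 + b 0%N) / 2 + (1 - b 0%N) / 2 = 1 by field.
have bt : b 0%N * t 0%N = (1 + b 0%N) / 2 * ((-1) ^+ false * t 0%N)
    + (1 - b 0%N) / 2 * ((-1) ^+ true * t 0%N).
  by rewrite expr0 expr1; field.
rewrite bt (convex_split _ _ _ _ _ pm).
apply: le_trans (dual_normD Ksup _ _) _; rewrite !(dual_normZ Ksup).
rewrite !ger0_norm // -[leRHS]mul1r -[X in X * D]pm [leRHS]mulrDl.
by rewrite lerD // ler_wpM2l // hs.
Qed.

(** Write the coefficients as real and imaginary multiples, of modulus at most 1,
    of t_i / r: each of the two parts is a convex combination of signed versions
    of [lin t s], which unconditionality bounds by C * D. *)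
Lemma unconditional_bounded (C D r : K) s (t : nat -> K) :
  splits_real_imaginary K -> 0 < r -> (forall i, r <= t i) -> 0 <= C ->
  unconditional_seq C s -> dual_norm (lin t s) <= D ->
  bounded_comb (r^-1 * (C * D + C * D)) s.
Proof.
move=> [j j1 split] r0 rt C0 sC tD a a1.
have t0 i : 0 < t i by exact: lt_le_trans r0 (rt i).
have CD : 0 <= C * D.
  by rewrite mulr_ge0 //; apply: le_trans tD; exact: dual_norm_ge0.
have real_bound (b : nat -> K) : (forall i, b i \is Num.real) ->
    (forall i, `|b i| <= 1) -> dual_norm (lin (fun i => b i * t i) s) <= C * D.
  move=> br b1; have := @sign_convexity (C * D) t s 0 b.
  rewrite add0r; apply=> // e; rewrite add0r.
  by apply: le_trans (sC t e) _; rewrite ler_wpM2l.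
have hb i : exists bc : K * K, [/\ bc.1 \is Num.real, bc.2 \is Num.real,
    `|bc.1| <= 1, `|bc.2| <= 1 & r * a i / t i = bc.1 + j * bc.2].
  have [|b [c [? ? ? ? ?]]] := split (r * a i / t i); last by exists (b, c).
  rewrite !normrM normfV (gtr0_norm (t0 i)) (gtr0_norm r0) ler_pdivrMr // mul1r.
  by apply: le_trans (rt i); rewrite -[leRHS]mulr1 ler_wpM2l // ltW.
have [bc hbc] := choice hb.
have -> : lin a s = r^-1 *: (lin (fun i => (bc i).1 * t i) s
                             + j *: lin (fun i => (bc i).2 * t i) s).
  rewrite -linZ -linD -linZ; apply: eq_lin => i.
  have [_ _ _ _ abc] := hbc i; rewrite mulrA -mulrDl -abc.
  by rewrite mulfVK ?gt_eqF // mulKf // gt_eqF.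
rewrite (dual_normZ Ksup) normfV gtr0_norm // ler_pM2l ?invr_gt0 //.
apply: le_trans (dual_normD Ksup _ _) _; rewrite (dual_normZ Ksup) lerD //.
  by apply: real_bound => i; case: (hbc i).
rewrite -[leRHS]mul1r ler_pM ?dual_norm_ge0 //.
by apply: real_bound => i; case: (hbc i).
Qed.

End Game.

(** * Long branches from the Szlenk index *)

Lemma ord_lt_irrefl (a : ord) : ~ ord_lt a a.
Proof.
rewrite /ord_lt; elim: a => [//|a IH|T f IH] /=; first exact: IH.
case=> i h; apply: (IH i); apply: (@ord_le_trans (Osucc (Osup f)) _ _ _ h) => /=.
exact/(@ord_le_sup _ _ i)/ord_le_refl.
Qed.

Definition ord_of_nat (n : nat) : ord := iter n Osucc Ozero.

Section Szlenk.
Context {K : numFieldType} (X : normedModType K).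
Implicit Types (A : set (dual X)) (eps : K).

Lemma szlenk_vanishes_first_nat eps A n :
  szlenk_derived eps A (ord_of_nat n) = set0 ->
  exists m, szlenk_vanishes_first eps A (ord_of_nat m).
Proof.
move=> An; have ex : exists m, `[< szlenk_derived eps A (ord_of_nat m) = set0 >].
  by exists n; exact/asboolP.
have [m /asboolP Am mmin] := ex_minnP ex.
exists m; split=> // b Ab; have [//|b_lt] := ord_le_total (ord_of_nat m) b.
case: m Am mmin b_lt => [//|m] Am mmin.
rewrite -[ord_lt _ _]/(ord_le b (ord_of_nat m)) => b_le.
suff /asboolP/mmin : szlenk_derived eps A (ord_of_nat m) = set0 by rewrite ltnn.
by apply/seteqP; split=> // f /(szlenk_derived_anti b_le); rewrite Ab.
Qed.

Lemma ord_of_nat_lt_omega n : ord_lt (ord_of_nat n) omega.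
Proof. by exists n.+1; exact: (ord_le_refl (ord_of_nat n.+1)). Qed.

(** Otherwise every [szlenk_at] would be a natural number, and their supremum
    would be at most omega. *)
Lemma szlenk_gt_omega : ordoo_lt (Some omega) (szlenk_index X) ->
  exists2 eps, 0 < eps &
    forall n, szlenk_derived eps (@dual_ball K X) (ord_of_nat n) !=set0.
Proof.
move=> om; apply: contrapT => nex.
have at_nat (e : {eps : K | 0 < eps}) : exists2 a,
    szlenk_at (@dual_ball K X) (val e) = Some a & ord_lt a omega.
  have [n Bn] : exists n,
      szlenk_derived (val e) (@dual_ball K X) (ord_of_nat n) = set0.
    apply/not_existsP => /= Bn; apply: nex; exists (val e); first exact: valP.
    by move=> n; apply/set0P/eqP.
  have [m Bm] := szlenk_vanishes_first_nat Bn.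
  rewrite /szlenk_at; case: pselect => [h|]; last by case; exists (ord_of_nat m).
  exists (projT1 (cid h)) => //; case: (projT2 (cid h)) => _ /(_ _ Bm.1) le.
  exact: ord_le_trans (ord_of_nat_lt_omega m).
move: om; rewrite /szlenk_index /ordoo_sup; case: asboolP => [[e ee]|_].
  by have [a] := at_nat e; rewrite ee.
case=> e /=; have [a -> a_lt] := at_nat e => /= om.
apply: (@ord_lt_irrefl a); apply: ord_le_trans a_lt _.
by apply: ord_lt_le.
Qed.

Hypothesis Ksup : sup_complete K.

(** The weak* neighbourhood of f in A given by F and r has diameter larger than eps,
    so one of two points at distance more than eps is farther than eps/2
    from f. *)
Lemma szlenk_derivation_far eps r A (F : seq X) (f : dual X) :
  0 < eps -> 0 < r -> szlenk_derivation eps A f ->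
  exists2 g, A g & eps / 2 < dual_norm (g - f) /\
    forall x, x \in F -> `|(g - f) x| <= r.
Proof.
move=> eps0 r0 [Af nf]; apply: contrapT => nex; apply: nf.
pose U : set (dual X) := [set g | forall x, x \in F -> `|g x - f x| < r].
exists (A `&` U); last by split=> // x _; rewrite subrr normr0.
split; first by exists U => //; exact: weakstar_open_nbhs.
have near g : (A `&` U) g -> dual_norm (g - f) <= eps / 2.
  move=> [Ag Ug]; apply: contrapT => /negP.
  rewrite -real_ltNge ?ger0_real ?dual_norm_ge0 ?divr_ge0 ?(ltW eps0) // => fg.
  by apply: nex; exists g => //; split=> // x /Ug /ltW.
move=> g h /near gf /near hf.
rewrite (_ : g - h = (g - f) - (h - f)); last by rewrite opprB addrA subrK.
apply: le_trans (dual_normB Ksup _ _) _.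
by apply: le_trans (lerD gf hf) _; rewrite -splitr.
Qed.

(** Each move goes from f in the current derived set to a g in the previous one
    and plays the normalization of y = g - f - e, where e is the correction of
    norm at most eta that puts y in the subspace. The corrections add up to
    eta * n. *)
Lemma szlenk_branch eps eta : 0 < eps -> 0 < eta -> eta <= eps / 4 ->
  forall n (f : dual X) (P : seq (dual X) -> Prop), forces n P ->
  szlenk_derived eps (@dual_ball K X) (ord_of_nat n) f ->
  exists s (t : nat -> K) h, [/\ P s, forall i, eps / 4 <= t i, dual_ball h
    & dual_norm (f + lin t s - h) <= eta *+ n].
Proof.
move=> eps0 eta0 eta4; elim=> [|n IH] f P /= hP fB.
  exists [::], (fun=> eps / 4), f; split=> //.
  by rewrite lin_nil addr0 subrr (dual_norm0 X Ksup).
case: hP => Y cY YP; have [F FY] := cof_contains_annihilator cY.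
have [C C0 approx] := annihilator_approx Ksup F.
have r0 : 0 < eta / C by rewrite divr_gt0.
have [g gB [gf gF]] := szlenk_derivation_far F eps0 r0 fB.
have [e] := approx _ _ (ltW r0) gF.
rewrite mulrC mulfVK ?gt_eqF // => e_eta /FY; set y := _ - e => Yy.
have y_large : eps / 4 <= dual_norm y.
  have : eps / 2 <= dual_norm y + eta.
    apply: le_trans (ltW gf) _; rewrite -[g - f](subrK e).
    by apply: le_trans (dual_normD Ksup _ _) _; rewrite lerD2l.
  have -> : eps / 2 = eps / 4 + eps / 4 by field.
  by rewrite -lerBlDr => /(le_trans _); apply; rewrite -addrA lerDl subr_ge0.
have y0 : 0 < dual_norm y by apply: lt_le_trans y_large; rewrite divr_gt0.
have /YP hP : sphere_of Y ((dual_norm y)^-1 *: y).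
  split; first by apply: subspaceZ => //; exact: cof_subspace.
  by rewrite /= (dual_normZ Ksup) normfV gtr0_norm // mulVf // gt_eqF.
have [s [t [h [Ps t_eps hB near]]]] := IH g _ hP gB.
exists ((dual_norm y)^-1 *: y :: s).
exists (fun i => if i is j.+1 then t j else dual_norm y), h.
split=> //; first by case.
rewrite lin_cons scalerA mulfV ?gt_eqF // scale1r.
rewrite (_ : _ - h = (g + lin t s - h) - e); last first.
  rewrite [f + _]addrA [f + y]addrA [f + (g - f)]addrC subrK.
  by rewrite (addrAC g) (addrAC (g + _)).
rewrite mulrSr; apply: le_trans (dual_normB Ksup _ _) _.
by rewrite lerD.
Qed.

(** The branch starts and ends in the dual ball, with eta chosen so that the
    corrections sum to at most 1; so the sum of its increments has norm at
    most 3. *)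
Lemma forces_bounded : splits_real_imaginary K ->
  ordoo_lt (Some omega) (szlenk_index X) ->
  weakstar_unconditional_asymptotic_structure X ->
  exists M : K, forall n P, forces n P -> exists2 s : seq (dual X), P s &
    bounded_comb M s.
Proof.
move=> split /szlenk_gt_omega[eps eps0 Bn] [C C1 hC].
have C0 : 0 <= C by exact: le_trans ler01 C1.
exists ((eps / 4)^-1 * (C * 3 + C * 3)) => n P hP.
have {}hC : forces n (@unconditional_seq K X C).
  case: n {hP} => [|n].
    by move=> a e; rewrite !lin_nil (dual_norm0 X Ksup) mulr0.
  apply: forces_mono (forces_of_game (hC n.+1 isT)) => _ [t <-].
  exact: unconditional_tuple.
have e4 : 0 < eps / 4 by rewrite divr_gt0.
have e4n : 0 < (eps / 4)^-1 + n%:R by rewrite ltr_wpDr // invr_gt0.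
pose eta := ((eps / 4)^-1 + n%:R)^-1.
have eta0 : 0 < eta by rewrite invr_gt0.
have eta4 : eta <= eps / 4.
  by rewrite -[leRHS]invrK lef_pV2 ?posrE ?invr_gt0 // lerDl.
have eta_n : eta *+ n <= 1.
  by rewrite -mulr_natr mulrC ler_pdivrMr // mul1r lerDr invr_ge0 ltW.
have [f fB] := Bn n.
have [s [t [h [[Ps sC] t_eps hB near]]]] :=
  szlenk_branch eps0 eta0 eta4 (forces_and hP hC) fB.
exists s => //; apply: (unconditional_bounded Ksup split e4 t_eps C0 sC).
have f1 : dual_norm f <= 1.
  exact: (@szlenk_derived_anti _ _ eps _ Ozero (ord_of_nat n) Logic.I f fB).
rewrite (_ : lin t s = (f + lin t s - h) - (f - h)); last first.
  by rewrite opprB addrA subrK addrC addKr.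
apply: le_trans (dual_normB Ksup _ _) _.
rewrite (_ : 3 = 1 + (1 + 1)); last by ring.
apply: lerD; first exact: le_trans near eta_n.
by apply: le_trans (dual_normB Ksup _ _) _; rewrite lerD.
Qed.

End Szlenk.

(** * Equivalence with the basis of l_infinity *)

Section Linfty.
Context {K : numFieldType}.

Lemma linfty_sumE n (a : 'I_n -> K) (i : 'I_n) :
  (\sum_(j < n) a j *: tnth (linfty_basis K n) j) 0 i = a i.
Proof.
rewrite summxE (bigD1 i) //= big1 ?addr0 => [|j ji].
  by rewrite tnth_mktuple !mxE !eqxx mulr1.
by rewrite tnth_mktuple !mxE eq_sym (negbTE ji) andbF mulr0.
Qed.

Lemma rV_norm_ge n (v : 'rV[K]_n) (i : 'I_n) : `|v 0 i| <= `|v|.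
Proof.
have : (`|v 0 i|%:nng : {nonneg K}) <=
    \big[Num.max/0%:nng]_(j : 'I_1 * 'I_n) `|v j.1 j.2|%:nng.
  by apply/bigmax_geP; right; exists (0, i).
by rewrite -num_le -mx_normE.
Qed.

Lemma rV_norm_attained n (v : 'rV[K]_n) :
  `|v| = 0 \/ exists i, `|v| = `|v 0 i|.
Proof.
have [->|v0] := eqVneq v 0; first by left; rewrite normr0.
have /mx_norm_neq0[[j i]] : mx_norm v != 0 by rewrite -[mx_norm v]/`|v| normr_eq0.
by rewrite ord1 => vi; right; exists i.
Qed.

Lemma linfty_normalized n : normalized_basis (linfty_basis K n).
Proof.
split=> [i|v].
  pose e := tnth (linfty_basis K n) i.
  have eE j : e 0 j = (j == i)%:R by rewrite /e tnth_mktuple mxE eqxx.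
  apply/eqP; rewrite eq_le; apply/andP; split.
    by have [->|[j ->]] := rV_norm_attained e; rewrite ?ler01 // eE;
      case: eqP => _; rewrite ?normr1 // normr0 ler01.
  by have := rV_norm_ge e i; rewrite eE eqxx normr1.
exists [ffun i => v 0 i]; split=> [|a ->].
  by apply/rowP => i; rewrite linfty_sumE ffunE.
by apply/ffunP => i; rewrite ffunE linfty_sumE.
Qed.

(** For the lower bound, change all signs except at an index j where |a_j| is
    maximal: the two combinations add up to 2 a_j t_j, of norm 2 |a_j|, and
    the second one is at most (1 + d) |a_j|. *)
Lemma equivalent_linfty (X : normedModType K) n (d : K)
    (t : n.-tuple (dual X)) :
  sup_complete K -> 0 < d -> d < 1 ->
  (forall i, dual_norm (tnth t i) = 1) -> bounded_comb (1 + d) t ->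
  equivalent_to ((1 - d)^-1 * (1 + d)) (linfty_basis K n) t.
Proof.
move=> Ksup d0 d1 t1 td.
exists (1 - d)^-1, (1 + d); split; rewrite ?invr_gt0 ?subr_gt0 ?addr_gt0 // => a.
rewrite invrK; set v : 'rV[K]_n := \sum_(i < n) _; set L := `|v|.
have aL i : `|a i| <= L by rewrite -(linfty_sumE a i); exact: rV_norm_ge.
have upper (b : 'I_n -> K) : (forall i, `|b i| <= L) ->
    dual_norm (\sum_(i < n) b i *: tnth t i) <= (1 + d) * L.
  move=> bL; have [L0|L0] := eqVneq L 0.
    rewrite big1 ?dual_norm0 ?L0 ?mulr0 // => i _.
    by move: (bL i); rewrite L0 normr_le0 => /eqP->; rewrite scale0r.
  have {}L0 : 0 < L by rewrite lt_def L0 normr_ge0.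
  (* The default 0 extends the coefficients beyond n. *)
pose c i := L^-1 * oapp b 0 (insub i).
  have -> : \sum_(i < n) b i *: tnth t i = L *: lin c t.
    rewrite -linZ lin_tuple; apply: eq_bigr => i _.
    by rewrite /c valK /= mulrA mulfV ?gt_eqF // mul1r.
  rewrite dual_normZ // gtr0_norm // mulrC ler_pM2r //; apply: td => i.
  rewrite /c normrM normfV (gtr0_norm L0) mulrC ler_pdivrMr // mul1r.
  by case: (insub i) => [j|] /=; [exact: bL|rewrite normr0 ltW].
apply/andP; split; last exact: upper.
have [L0|[j Lj]] := rV_norm_attained v; first by rewrite /L L0 mulr0 dual_norm_ge0.
pose b i := if i == j then a j else - a i.
have := dual_normD Ksup (\sum_(i < n) a i *: tnth t i)
  (\sum_(i < n) b i *: tnth t i).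
have -> : \sum_(i < n) a i *: tnth t i + \sum_(i < n) b i *: tnth t i
    = (a j + a j) *: tnth t j.
  rewrite -big_split (bigD1 j) //= big1 ?addr0 => [|i ij].
    by rewrite /b eqxx scalerDl.
  by rewrite /b (negbTE ij) scaleNr subrr.
have bL i : `|b i| <= L by rewrite /b; case: eqP => _; rewrite ?normrN aL.
move=> /le_trans/(_ (lerD (lexx _) (upper b bL))).
rewrite (dual_normZ Ksup) t1 mulr1 -mulr2n normrMn.
rewrite -(linfty_sumE a j) -/v -Lj -/L -lerBlDr; apply: le_trans.
by rewrite mulr2n [leLHS](_ : _ = L + L - (1 + d) * L) //; ring.
Qed.

Lemma james_constant (eps : K) : 0 < eps ->
  1 + eps = (1 - eps / (2 + eps))^-1 * (1 + eps / (2 + eps)).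
Proof.
move=> eps0; have e2 : 2 + eps != 0 by rewrite gt_eqF // addr_gt0.
by field; rewrite e2 addrK pnatr_eq0.
Qed.

End Linfty.

Theorem mainTheorem4 (R : realType) (cplx : bool)
    (X : completeNormedModType (scalars R cplx)) :
  separable X ->
  ordoo_lt (Some omega) (szlenk_index X) ->
  weakstar_unconditional_asymptotic_structure X ->
  forall n : nat, (1 <= n)%N ->
    in_weakstar_asymptotic_structure X (linfty_basis (scalars R cplx) n).
Proof.
move=> _ szlenk uncond n _.
have Ksup := @scalars_sup_complete R cplx.
have [M hM] := forces_bounded Ksup (@scalars_split R cplx) szlenk uncond.
split; first exact: linfty_normalized.
move=> eps eps0; have eps2 : 0 < 2 + eps by rewrite addr_gt0.
have d0 : 0 < eps / (2 + eps) by rewrite divr_gt0.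
apply: (game_of_not_forces (james_game Ksup d0 hM)) => t t1 td.
rewrite (james_constant eps0); apply: equivalent_linfty => //.
by rewrite ltr_pdivrMr // mul1r ltrDr.
Qed.
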